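(* Let $\mathfrak{g}$ be a Leibniz subalgebra of the Leibniz algebra $\Xi$, $\mathfrak{h}$ a $\mathfrak{g}$-complement of $\Xi$ and $(\mathfrak{g},\mathfrak{h},\triangleright,\triangleleft,\leftharpoonup,\rightharpoonup)$ the associated canonical matched pair. Then $\sim$ is an equivalence relation on the set $\mathcal{D}\mathcal{M}(\mathfrak{h},\mathfrak{g}\,|\,(\triangleright,\triangleleft,\leftharpoonup,\rightharpoonup))$ of deformation maps and the map $$\mathcal{H}\mathcal{A}^2(\mathfrak{h},\mathfrak{g}\,|\,(\triangleright,\triangleleft,\leftharpoonup,\rightharpoonup)):=\mathcal{D}\mathcal{M}(\mathfrak{h},\mathfrak{g}\,|\,(\triangleright,\triangleleft,\leftharpoonup,\rightharpoonup))/\sim\ \longrightarrow\ \mathcal{F}(\mathfrak{g},\Xi),\qquad \overline{r}\mapsto\mathfrak{h}_r$$ is a bijection between $\mathcal{H}\mathcal{A}^2(\mathfrak{h},\mathfrak{g}\,|\,(\triangleright,\triangleleft,\leftharpoonup,\rightharpoonup))$ and the set $\mathcal{F}(\mathfrak{g},\Xi)$ of isomorphism classes of all $\mathfrak{g}$-complements of $\Xi$. In particular, the factorization index of $\mathfrak{g}$ in $\Xi$ is $$[\Xi:\mathfrak{g}]^f=|\mathcal{H}\mathcal{A}^2(\mathfrak{h},\mathfrak{g}\,|\,(\triangleright,\triangleleft,\leftharpoonup,\rightharpoonup))|.$$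
   Context: All vector spaces and linear maps are over an arbitrary field $k$. A Leibniz algebra is a vector space with a bilinear bracket satisfying $[g,[h,l]]=[[g,h],l]-[[g,l],h]$. A $\mathfrak{g}$-complement of $\Xi$ is a Leibniz subalgebra $\mathfrak{h}$ of $\Xi$ with $\Xi=\mathfrak{g}+\mathfrak{h}$ and $\mathfrak{g}\cap\mathfrak{h}=\{0\}$. $\mathcal{F}(\mathfrak{g},\Xi)$ is the set of isomorphism classes (as Leibniz algebras) of $\mathfrak{g}$-complements of $\Xi$, and $[\Xi:\mathfrak{g}]^f:=|\mathcal{F}(\mathfrak{g},\Xi)|$ is the factorization index. Given a $\mathfrak{g}$-complement $\mathfrak{h}$, let $p:\Xi\to\mathfrak{g}$, $p(g+x)=g$ for $g\in\mathfrak{g}$, $x\in\mathfrak{h}$. The canonical matched pair associated to $\Xi=\mathfrak{g}+\mathfrak{h}$ consists of the bilinear maps $\triangleright:\mathfrak{h}\times\mathfrak{g}\to\mathfrak{g}$, $\triangleleft:\mathfrak{h}\times\mathfrak{g}\to\mathfrak{h}$, $\leftharpoonup:\mathfrak{g}\times\mathfrak{h}\to\mathfrak{g}$, $\rightharpoonup:\mathfrak{g}\times\mathfrak{h}\to\mathfrak{h}$ given by $x\triangleright g=p([x,g])$, $x\triangleleft g=[x,g]-p([x,g])$, $g\leftharpoonup x=p([g,x])$, $g\rightharpoonup x=[g,x]-p([g,x])$. A deformation map is a linear map $r:\mathfrak{h}\to\mathfrak{g}$ with $$r([x,y])-[r(x),r(y)]=x\triangleright r(y)+r(x)\leftharpoonup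 y-r\bigl(x\triangleleft r(y)+r(x)\rightharpoonup y\bigr)$$ for all $x,y\in\mathfrak{h}$; $\mathcal{D}\mathcal{M}(\mathfrak{h},\mathfrak{g}\,|\,(\triangleright,\triangleleft,\leftharpoonup,\rightharpoonup))$ is the set of all deformation maps. For a deformation map $r$, $\mathfrak{h}_r$ is the vector space $\mathfrak{h}$ with the bracket $[x,y]_r=[x,y]+x\triangleleft r(y)+r(x)\rightharpoonup y$, which is a Leibniz algebra isomorphic to the $\mathfrak{g}$-complement $\{r(x)+x\mid x\in\mathfrak{h}\}$ of $\Xi$. Two deformation maps $r,R$ are equivalent, $r\sim R$, if there is a $k$-linear automorphism $\sigma:\mathfrak{h}\to\mathfrak{h}$ such that for all $x,y\in\mathfrak{h}$: $$\sigma([x,y])-[\sigma(x),\sigma(y)]=\sigma(x)\triangleleft R(\sigma(y))+R(\sigma(x))\rightharpoonup\sigma(y)-\sigma(x\triangleleft r(y))-\sigma(r(x)\rightharpoonup y).$$ *)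

(* Defs.v *)
From HB Require Import structures.
From mathcomp Require Import all_boot all_algebra.
From mathcomp Require Import boolp classical_sets functions cardinality.
From Stdlib Require Import RelationClasses.

Set Implicit Arguments.
Unset Strict Implicit.
Unset Printing Implicit Defensive.

Import GRing.Theory.

Local Open Scope classical_set_scope.
Local Open Scope ring_scope.
Local Open Scope card_scope.

(* "Leibniz" means right Leibniz: each [- , z] is a derivation. *)
HB.mixin Record Lmodule_isLeibniz (k : fieldType) L & GRing.Lmodule k L := {
  lbracket : L -> L -> L;
  lbracket_linearr : forall x : L, linear (lbracket x);
  lbracket_linearl : forall y : L, linear (lbracket^~ y);
  leibnizP : forall x y z : L,
    lbracket x (lbracket y z) =
    lbracket (lbracket x y) z - lbracket (lbracket x z) y
}.

#[short(type="leibnizType")]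
HB.structure Definition Leibniz (k : fieldType) :=
  {L of Lmodule_isLeibniz k L & GRing.Lmodule k L}.

Notation "⟦ x , y ⟧" := (lbracket x y) (at level 0, format "⟦ x ,  y ⟧").

Section BracketTheory.
Variables (k : fieldType) (L : leibnizType k).
Implicit Types x y z : L.

Lemma lbracketDr x y z : ⟦x, y + z⟧ = ⟦x, y⟧ + ⟦x, z⟧.
Proof. by have := lbracket_linearr x 1 y z; rewrite !scale1r. Qed.

Lemma lbracketDl x y z : ⟦x + y, z⟧ = ⟦x, z⟧ + ⟦y, z⟧.
Proof. by have := lbracket_linearl z 1 x y; rewrite !scale1r. Qed.

End BracketTheory.

Definition leibniz_iso (k : fieldType) (L M : leibnizType k) : Prop :=
  exists f : {linear L -> M},
    bijective f /\ forall x y : L, f ⟦x, y⟧ = ⟦f x, f y⟧.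

(* Boolean predicates are no restriction here: in the classical setting of
   boolp, every subset of L is the extension of one. *)
HB.mixin Record isBracketClosed (k : fieldType) (L : leibnizType k)
    (S : {pred L}) := {
  rpred_lbracket_subproof : {in S &, forall x y, ⟦x, y⟧ \in S}
}.

#[short(type="leibnizClosed")]
HB.structure Definition LeibnizClosed (k : fieldType) (L : leibnizType k) :=
  {S of isBracketClosed k L S & GRing.AddClosed L S & GRing.isScaleClosed k L S}.

Lemma rpred_lbracket (k : fieldType) (L : leibnizType k)
  (S : leibnizClosed L) : {in S &, forall x y, ⟦x, y⟧ \in S}.
Proof. exact: rpred_lbracket_subproof. Qed.

Lemma leibnizClosedB (k : fieldType) (L : leibnizType k)
  (S : leibnizClosed L) : {in S &, forall x y, x - y \in S}.
Proof. by move=> x y Sx Sy; rewrite -scaleN1r rpredD ?rpredZ. Qed.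

Section Subalgebra.
Variables (k : fieldType) (L : leibnizType k) (S : leibnizClosed L).

Definition subleib := {x : L | x \in S}.

HB.instance Definition _ := [isSub of subleib for @sval _ _].
HB.instance Definition _ := [Choice of subleib by <:].
HB.instance Definition _ := [SubChoice_isSubLmodule of subleib by <:].

Definition subleib_bracket (x y : subleib) : subleib :=
  Sub ⟦val x, val y⟧ (rpred_lbracket (valP x) (valP y)).

Fact subleib_linearr x : linear (subleib_bracket x).
Proof.
by move=> a y z; apply: val_inj; rewrite linearP /= lbracket_linearr.
Qed.

Fact subleib_linearl y : linear (subleib_bracket^~ y).
Proof.
by move=> a x z; apply: val_inj; rewrite linearP /= lbracket_linearl.
Qed.

Fact subleibP x y z : subleib_bracket x (subleib_bracket y z) =
  subleib_bracket (subleib_bracket x y) z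
  - subleib_bracket (subleib_bracket x z) y.
Proof. by apply: val_inj; rewrite raddfB /= leibnizP. Qed.

HB.instance Definition _ := Lmodule_isLeibniz.Build k subleib
  subleib_linearr subleib_linearl subleibP.

End Subalgebra.

Definition is_complement (k : fieldType) (Xi : leibnizType k)
    (g h : leibnizClosed Xi) : Prop :=
  (forall u : Xi, exists a : subleib g, exists x : subleib h,
     u = val a + val x) /\
  (forall u : Xi, u \in g -> u \in h -> u = 0).

Section MatchedPair.
Variables (k : fieldType) (Xi : leibnizType k) (g h : leibnizClosed Xi).
Hypothesis gh : is_complement g h.

Fact proj_subproof (u : Xi) : exists a : subleib g, u - val a \in h.
Proof. by have [a [x ->]] := gh.1 u; exists a; rewrite addrC addKr; case: x. Qed.

Definition proj (u : Xi) : subleib g := xchoose (proj_subproof u).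

Fact coproj_subproof (u : Xi) : u - val (proj u) \in h.
Proof. exact: xchooseP (proj_subproof u). Qed.

Definition coproj (u : Xi) : subleib h := Sub (u - val (proj u)) (coproj_subproof u).

Lemma projE (a : subleib g) (x : subleib h) : proj (val a + val x) = a.
Proof.
apply/val_inj/eqP; rewrite -subr_eq0; apply/eqP/gh.2.
  exact: leibnizClosedB (valP _) (valP _).
have := leibnizClosedB (valP x) (coproj_subproof (val a + val x)).
by rewrite opprB opprD addrCA [X in _ + X]addrCA subrr addr0.
Qed.

Lemma proj_coproj u : u = val (proj u) + val (coproj u).
Proof. by rewrite /= addrC subrK. Qed.

Lemma coprojE (a : subleib g) (x : subleib h) : coproj (val a + val x) = x.
Proof. by apply: val_inj; rewrite /= projE addrC addKr. Qed.

Lemma projP (a : subleib g) (x : subleib h) u : u = val a + val x -> proj u = a.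
Proof. by move=> ->; apply: projE. Qed.

Lemma coprojP (a : subleib g) (x : subleib h) u : u = val a + val x -> coproj u = x.
Proof. by move=> ->; apply: coprojE. Qed.

Fact proj_linear : linear proj.
Proof.
move=> a u v; apply: (@projP _ (a *: coproj u + coproj v)).
rewrite {1}(proj_coproj u) {1}(proj_coproj v) !linearP scalerDr.
by rewrite addrACA.
Qed.
HB.instance Definition _ := GRing.isLinear.Build k Xi (subleib g) _ proj proj_linear.

Fact coproj_linear : linear coproj.
Proof.
move=> a u v; apply: (@coprojP (a *: proj u + proj v)).
rewrite {1}(proj_coproj u) {1}(proj_coproj v) !linearP scalerDr.
by rewrite addrACA.
Qed.
HB.instance Definition _ := GRing.isLinear.Build k Xi (subleib h) _ coproj coproj_linear.

(* The canonical matched pair (▷, ◁, ↼, ⇀), in this order. *)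
Definition act_gt (x : subleib h) (a : subleib g) : subleib g := proj ⟦val x, val a⟧.
Definition act_lt (x : subleib h) (a : subleib g) : subleib h := coproj ⟦val x, val a⟧.
Definition harp_l (a : subleib g) (x : subleib h) : subleib g := proj ⟦val a, val x⟧.
Definition harp_r (a : subleib g) (x : subleib h) : subleib h := coproj ⟦val a, val x⟧.

Local Notation "x ▷ a" := (act_gt x a) (at level 40).
Local Notation "x ◁ a" := (act_lt x a) (at level 40).
Local Notation "a ↼ x" := (harp_l a x) (at level 40).
Local Notation "a ⇀ x" := (harp_r a x) (at level 40).

Record deformation_map := DeformationMap {
  dm_map :> {linear subleib h -> subleib g};
  dm_mapP : forall x y : subleib h,
    dm_map ⟦x, y⟧ - ⟦dm_map x, dm_map y⟧ =
    x ▷ dm_map y + dm_map x ↼ y - dm_map (x ◁ dm_map y + dm_map x ⇀ y)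
}.

Definition dm_equiv (r R : deformation_map) : Prop :=
  exists sigma : {linear subleib h -> subleib h}, bijective sigma /\
    forall x y : subleib h,
      sigma ⟦x, y⟧ - ⟦sigma x, sigma y⟧ =
      sigma x ◁ R (sigma y) + R (sigma x) ⇀ sigma y
      - sigma (x ◁ r y) - sigma (r x ⇀ y).

Definition dm_class (r : deformation_map) : set deformation_map :=
  [set R | dm_equiv r R].

Definition HA2 : set (set deformation_map) := range dm_class.

(* Alias of [subleib h]; the argument r selects the deformed bracket. *)
Definition deformed (r : deformation_map) : Type := subleib h.

Section Deformation.
Variable r : deformation_map.
Local Notation hr := (deformed r).

HB.instance Definition _ := GRing.Lmodule.on hr.

Definition deformed_bracket (x y : hr) : hr :=
  (⟦(x : subleib h), (y : subleib h)⟧ + x ◁ r y + r x ⇀ y : subleib h).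

Definition dm_graph (x : hr) : Xi := val (r x) + val (x : subleib h).

Fact dm_graph_inj : injective dm_graph.
Proof.
by move=> x y /(congr1 coproj); rewrite /dm_graph !coprojE.
Qed.

Fact dm_graph_linear : linear dm_graph.
Proof. by move=> a x y; rewrite /dm_graph !linearP scalerDr addrACA. Qed.
HB.instance Definition _ :=
  GRing.isLinear.Build k hr Xi _ dm_graph dm_graph_linear.

Lemma dm_graph_bracket x y :
  dm_graph (deformed_bracket x y) = ⟦dm_graph x, dm_graph y⟧.
Proof.
have defr : r (deformed_bracket x y) =
    ⟦r (x : subleib h), r (y : subleib h)⟧ + x ▷ r y + r x ↼ y.
  rewrite /deformed_bracket -addrA linearD.
  move: (dm_mapP r x y) => /eqP; rewrite subr_eq => /eqP ->.
  by rewrite addrAC subrK addrC addrA.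
rewrite /dm_graph lbracketDl !lbracketDr defr.
have -> : val (deformed_bracket x y : subleib h) =
    ⟦val (x : subleib h), val (y : subleib h)⟧
    + val (x ◁ r y) + val (r x ⇀ y) by [].
have -> : val (⟦r x, r y⟧ + x ▷ r y + r x ↼ y) =
    ⟦val (r x), val (r y)⟧ + val (x ▷ r y) + val (r x ↼ y) by [].
rewrite (proj_coproj ⟦val (r x), val (y : subleib h)⟧).
rewrite (proj_coproj ⟦val (x : subleib h), val (r y)⟧).
rewrite -/(harp_l _ _) -/(harp_r _ _) -/(act_gt _ _) -/(act_lt _ _).
move: (val (x ◁ _)) (val (_ ⇀ _)) (val (_ ▷ _)) (val (_ ↼ _)) => A B C D.
by rewrite !addrA [RHS](ACl (1*4*2*6*5*3))%AC.
Qed.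

Fact deformed_linearr x : linear (deformed_bracket x).
Proof.
move=> a y z; apply: dm_graph_inj.
by rewrite linearP /= !dm_graph_bracket linearP lbracket_linearr.
Qed.

Fact deformed_linearl y : linear (deformed_bracket^~ y).
Proof.
move=> a x z; apply: dm_graph_inj.
by rewrite linearP /= !dm_graph_bracket linearP lbracket_linearl.
Qed.

Fact deformed_leibnizP x y z : deformed_bracket x (deformed_bracket y z) =
  deformed_bracket (deformed_bracket x y) z
  - deformed_bracket (deformed_bracket x z) y.
Proof.
by apply: dm_graph_inj; rewrite raddfB /= !dm_graph_bracket leibnizP.
Qed.

HB.instance Definition _ := Lmodule_isLeibniz.Build k hr
  deformed_linearr deformed_linearl deformed_leibnizP.

End Deformation.
End MatchedPair.

Arguments HA2 {k Xi g h} gh _.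

Section FactorizationClasses.
Variables (k : fieldType) (Xi : leibnizType k) (g : leibnizClosed Xi).

(* The isomorphism class of L among the g-complements of Xi. *)
Definition iso_class (L : leibnizType k) : set (leibnizClosed Xi) :=
  [set c | is_complement g c /\ leibniz_iso (subleib c) L].

Definition iso_classes : set (set (leibnizClosed Xi)) :=
  [set iso_class (subleib c) | c in is_complement g].

End FactorizationClasses.

(* Main.v *)
(* The complements of g are exactly the graphs {r(x) + x | x in h} of the
   deformation maps r, and the graph of r, as a subalgebra of Xi, is isomorphic
   to h_r.  Moreover r ~ R says precisely that h_r and h_R are isomorphic, so
   every assertion reduces to isomorphism being an equivalence relation. *)
Require Import Defs.
From HB Require Import structures.
From mathcomp Require Import all_boot all_algebra.
From mathcomp Require Import boolp classical_sets functions cardinality.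
From Stdlib Require Import RelationClasses.

Set Implicit Arguments.
Unset Strict Implicit.
Unset Printing Implicit Defensive.

Import GRing.Theory.

Local Open Scope classical_set_scope.
Local Open Scope card_scope.

Section LeibnizIso.
Local Open Scope ring_scope.
Variable k : fieldType.
Implicit Types L M N : leibnizType k.

Lemma leibniz_iso_sym L M : leibniz_iso L M -> leibniz_iso M L.
Proof.
move=> [f [[f' fK f'K] fM]].
pose f'L := GRing.isLinear.Build k M L _ f' (can2_linear fK f'K).
pose F : {linear M -> L} := HB.pack f' f'L.
exists F; split; first by exists f.
by move=> x y; apply: (can_inj fK); rewrite fM !f'K.
Qed.

Lemma leibniz_iso_trans L M N :
  leibniz_iso L M -> leibniz_iso M N -> leibniz_iso L N.
Proof.
move=> [f [fb fM]] [f' [f'b f'M]].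
exists (f' \o f : {linear L -> N}); split; first exact: bij_comp.
by move=> x y /=; rewrite fM f'M.
Qed.

End LeibnizIso.

Section Graphs.
Local Open Scope ring_scope.
Variables (k : fieldType) (Xi : leibnizType k) (g h : leibnizClosed Xi).
Hypothesis gh : is_complement g h.
Implicit Types r R : deformation_map gh.

(** The same [sigma] serves on both sides: with the deformed brackets unfolded, being a morphism
    from [deformed r] to [deformed R] is the identity of [dm_equiv] with its terms moved across, a
    rearrangement done once in [E]. *)
Lemma dm_equiv_iso r R :
  dm_equiv r R <-> leibniz_iso (deformed r) (deformed R).
Proof.
have E (V : zmodType) (a b c d e f : V) :
    (a - b = e + f - c - d) <-> (a + c + d = b + e + f).
  have eq_rearr : (a - b == e + f - c - d) = (a + c + d == b + e + f).
    rewrite subr_eq addrAC eq_sym subr_eq addrAC subr_eq eq_sym.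
    by rewrite addrAC [e + f + b]addrC addrA.
  by split=> /eqP eq1; apply/eqP; rewrite ?eq_rearr // -eq_rearr.
split=> -[s [sb sP]]; exists s; split=> // x y.
  by have /E := sP x y; rewrite -!linearD.
by apply/E; rewrite -!linearD; apply: sP.
Qed.

(** Stated as an equation between the two components rather than as an image, which makes it boolean
    and lets the linear closure properties follow from linearity of both sides. *)
Definition graph_pred r : {pred Xi} := [pred u | proj gh u == r (coproj gh u)].

Lemma graph_predP r u :
  reflect (exists x : deformed r, u = dm_graph x) (u \in graph_pred r).
Proof.
apply: (iffP eqP) => [ru|[x ->]].
  by exists (coproj gh u); rewrite /dm_graph -ru -proj_coproj.
by rewrite /dm_graph projE coprojE.
Qed.

Fact graph_pred_add r : addr_closed (graph_pred r).
Proof.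
split=> [|u v]; first by rewrite inE !raddf0.
by rewrite !inE => /eqP ru /eqP rv; rewrite !raddfD /= ru rv.
Qed.

Fact graph_pred_scale r : GRing.scaler_closed (graph_pred r).
Proof. by move=> a u; rewrite !inE => /eqP ru; rewrite !linearZ /= ru. Qed.

Fact graph_pred_bracket r :
  {in graph_pred r &, forall u v, ⟦u, v⟧ \in graph_pred r}.
Proof.
move=> _ _ /graph_predP[x ->] /graph_predP[y ->].
by apply/graph_predP; exists (deformed_bracket x y); rewrite dm_graph_bracket.
Qed.

HB.instance Definition _ r :=
  GRing.isAddClosed.Build Xi (graph_pred r) (graph_pred_add r).
HB.instance Definition _ r :=
  GRing.isScaleClosed.Build k Xi (graph_pred r) (@graph_pred_scale r).
HB.instance Definition _ r :=
  isBracketClosed.Build k Xi (graph_pred r) (@graph_pred_bracket r).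

Definition graph r : leibnizClosed Xi := graph_pred r.

Lemma graph_complement r : is_complement g (graph r).
Proof.
split=> [u|u gu /eqP].
  have rP : dm_graph (coproj gh u : deformed r) \in graph r.
    by apply/graph_predP; exists (coproj gh u).
  (* For u = a + x along [g] and [h], write u = (a - r x) + (r x + x). *)
  exists (proj gh u - r (coproj gh u)), (Sub (dm_graph _) rP).
  by rewrite raddfB /= addrA subrK -proj_coproj.
(* The [h]-component of u is 0, so lying in the graph forces its [g]-component to be r 0 = 0. *)
have -> : u = val (Sub u gu : subleib g) + val (0 : subleib h).
  by rewrite /= addr0.
by rewrite projE coprojE raddf0 => ->; rewrite !raddf0 addr0.
Qed.

(** The isomorphism is [dm_graph], with inverse the restriction of [coproj gh]. Only extensional
    equality with the graph is asked, so that the result also applies to a complement given in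
    advance. *)
Lemma eq_graph_iso r (c : leibnizClosed Xi) :
  c =i graph_pred r -> leibniz_iso (subleib c) (deformed r).
Proof.
move=> cr; apply: leibniz_iso_sym.
have rP (x : deformed r) : dm_graph x \in c.
  by rewrite cr; apply/graph_predP; exists x.
pose f x : subleib c := Sub (dm_graph x) (rP x).
have fL : linear f by move=> a x y; apply: val_inj; rewrite linearP /= linearP.
pose fI := GRing.isLinear.Build k (deformed r) (subleib c) _ f fL.
pose F : {linear deformed r -> subleib c} := HB.pack f fI.
exists F; split.
  exists (fun u => coproj gh (val u)) => [x|[u cu]]; first exact: coprojE.
  have /graph_predP[x ux] : u \in graph_pred r by rewrite -cr.
  by apply: val_inj; rewrite /= ux coprojE.
by move=> x y; apply: val_inj; rewrite /= -dm_graph_bracket.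
Qed.

Lemma graph_iso r : leibniz_iso (subleib (graph r)) (deformed r).
Proof. exact: eq_graph_iso. Qed.

Section DeformationOfComplement.
Variable c : leibnizClosed Xi.
Hypothesis gc : is_complement g c.

(** If x = a + y with a in [g] and y in [c], then -a + x = y lies in [c]; the sign thus places the
    graph of this map inside [c]. *)
Definition complement_map (x : subleib h) : subleib g := - proj gc (val x).

Fact complement_map_linear : linear complement_map.
Proof.
by move=> a x y; rewrite /complement_map !linearP.
Qed.
HB.instance Definition _ := GRing.isLinear.Build k (subleib h) (subleib g) _
  complement_map complement_map_linear.

Lemma complement_graphE (x : subleib h) :
  val (complement_map x) + val x = val (coproj gc (val x)).
Proof. by rewrite raddfN addrC. Qed.

(** For u = a + x in [c], x = -a + u is the decomposition of x along [g] and [c], and uniqueness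
    identifies -a. Hence [c] lies inside the graph. *)
Lemma proj_complement u : u \in c -> proj gh u = complement_map (coproj gh u).
Proof.
move=> cu; rewrite /complement_map.
have /(projP gc) -> : val (coproj gh u) =
    val (- proj gh u) + val (Sub u cu : subleib c).
  by rewrite raddfN /= addrC.
by rewrite opprK.
Qed.

(** The bracket of r x + x and r y + y stays in [c], so its [g]-component is r of its [h]-component;
    expanding both components gives the deformation equation. *)
Fact complement_mapP (x y : subleib h) :
  complement_map ⟦x, y⟧ - ⟦complement_map x, complement_map y⟧ =
  act_gt gh x (complement_map y) + harp_l gh (complement_map x) y
  - complement_map (act_lt gh x (complement_map y)
                    + harp_r gh (complement_map x) y).
Proof.
set r := complement_map.
have /proj_complement : ⟦val (r x) + val x, val (r y) + val y⟧ \in c.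
  by rewrite !complement_graphE; apply: rpred_lbracket; apply: valP.
have rD : {morph r : u v / u + v} by exact: raddfD.
have pD : {morph proj gh : u v / u + v} by exact: raddfD.
have qD : {morph coproj gh : u v / u + v} by exact: raddfD.
rewrite lbracketDl !lbracketDr !pD !qD.
(* Brackets within [g] or within [h] have zero component in the other summand; the mixed brackets
   supply the four actions. *)
have -> : proj gh ⟦val (r x), val (r y)⟧ = ⟦r x, r y⟧.
  by apply: (@projP _ _ _ _ gh _ 0); rewrite addr0.
have -> : coproj gh ⟦val (r x), val (r y)⟧ = 0.
  by apply: (@coprojP _ _ _ _ gh ⟦r x, r y⟧); rewrite addr0.
have -> : proj gh ⟦val x, val y⟧ = 0.
  by apply: (@projP _ _ _ _ gh _ ⟦x, y⟧); rewrite add0r.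
have -> : coproj gh ⟦val x, val y⟧ = ⟦x, y⟧.
  by apply: (@coprojP _ _ _ _ gh 0); rewrite add0r.
rewrite -/(act_gt gh _ _) -/(act_lt gh _ _) -/(harp_l gh _ _) -/(harp_r gh _ _).
rewrite add0r addr0 -/r [_ + (_ + ⟦x, y⟧)]addrA.
rewrite [r (harp_r _ _ _ + _ + _)]rD => eq_rxy; apply/eqP.
rewrite subr_eq addrAC eq_sym subr_eq -/r [act_lt _ _ _ + _]addrC.
by rewrite [r _ + _]addrC -eq_rxy addrC [act_gt _ _ _ + _]addrC addrA.
Qed.

Definition complement_dm : deformation_map gh :=
  DeformationMap (dm_map := complement_map) complement_mapP.

Lemma complement_dm_iso : leibniz_iso (subleib c) (deformed complement_dm).
Proof.
apply: eq_graph_iso => u; apply/idP/graph_predP => [cu|[x ->]].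
  by apply/graph_predP/eqP; apply: proj_complement.
by rewrite /dm_graph complement_graphE; apply: valP.
Qed.

End DeformationOfComplement.

Lemma iso_class_eq (L M : leibnizType k) :
  leibniz_iso L M -> iso_class g L = iso_class g M.
Proof.
move=> LM; apply/seteqP; split=> c [gc cL]; split=> //.
  exact: leibniz_iso_trans LM.
exact/(leibniz_iso_trans cL)/leibniz_iso_sym.
Qed.

(** This turns [dm_equiv] into an equality of sets, from which it inherits being an equivalence
    relation. From left to right, the graph of r is a complement in the first class, hence in the
    second, and it links the two deformed algebras. *)
Lemma iso_class_deformed_eq r R :
  iso_class g (deformed r) = iso_class g (deformed R) <-> dm_equiv r R.
Proof.
rewrite dm_equiv_iso; split=> [rR|]; last exact: iso_class_eq.
have : iso_class g (deformed r) (graph r).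
  by split; [apply: graph_complement | apply: graph_iso].
rewrite rR => -[_]; apply: leibniz_iso_trans.
exact/leibniz_iso_sym/graph_iso.
Qed.

Lemma dm_equiv_equivalence : Equivalence (@dm_equiv k Xi g h gh).
Proof.
split=> [r|r R|r R S].
- exact/iso_class_deformed_eq.
- by rewrite -!iso_class_deformed_eq.
- by rewrite -!iso_class_deformed_eq => ->.
Qed.

Lemma dm_class_eq r R : dm_class r = dm_class R <-> dm_equiv r R.
Proof.
have [rfl sym trans] := dm_equiv_equivalence.
split=> [rR|rR].
  by have := rfl R; rewrite -[dm_equiv R R]/(dm_class R R) -rR.
by apply/seteqP; split=> S; apply: trans => //; apply: sym.
Qed.

End Graphs.

Theorem theorem5p5 (k : fieldType) (Xi : leibnizType k) (g h : leibnizClosed Xi)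
    (gh : is_complement g h) :
  Equivalence (@dm_equiv k Xi g h gh) /\
  (exists Phi : set (deformation_map gh) -> set (leibnizClosed Xi),
     (forall r : deformation_map gh, Phi (dm_class r) = iso_class g (deformed r)) /\
     set_bij (HA2 gh) (iso_classes g) Phi) /\
  iso_classes g #= HA2 gh.
Proof.
have eqv := dm_equiv_equivalence gh; split=> //.
suff [Phi [PhiE Phi_bij]] : exists Phi : set (deformation_map gh) -> _,
     (forall r, Phi (dm_class r) = iso_class g (deformed r)) /\
     set_bij (HA2 gh) (iso_classes g) Phi.
  split; first by exists Phi.
  by rewrite card_eq_sym; apply/card_set_bijP; exists Phi.
(* The union avoids choosing a representative: over a class of [dm_equiv] all its members
   coincide. *)
pose Phi (A : set (deformation_map gh)) :=
  \bigcup_(r in A) iso_class g (deformed r).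
have PhiE r : Phi (dm_class r) = iso_class g (deformed r).
  apply/seteqP; split=> [c [R /iso_class_deformed_eq <-]|c rc] //.
  by exists r => //; reflexivity.
exists Phi; split=> //; split.
(* [deformed r] is not itself a subalgebra of [Xi]; the graph of r realises its class by an actual
   complement. *)
- move=> _ [r _ <-]; exists (graph r); first exact: graph_complement.
  by rewrite PhiE; apply/iso_class_eq/graph_iso.
- move=> _ _ /set_mem[r _ <-] /set_mem[R _ <-].
  by rewrite !PhiE => /iso_class_deformed_eq/dm_class_eq.
- move=> _ [c gc <-]; pose r := complement_dm gh gc.
  exists (dm_class r); first by exists r.
  by rewrite PhiE; apply/iso_class_eq/leibniz_iso_sym/complement_dm_iso.
Qed.
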